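(* For every integer $d \geq 1$, let $b(d)$ be the maximum cardinality of a minimal edge cover of degree $d$ of a complete bipartite graph. Then $$3 \cdot 2^{d-1} - 2 \leq b(d) \leq (d-1)\binom{2d-1}{d} + 1.$$
   Context: For a finite graph $G$, a family $\mathcal{H}$ of subsets of $V(G)$ is an edge cover of $G$ iff every edge of $G$ (viewed as a 2-element vertex set) is included in some member of $\mathcal{H}$; it is a minimal edge cover iff no proper subfamily of $\mathcal{H}$ is an edge cover of $G$. $\mathcal{H}$ has degree $d$ if every vertex of $G$ belongs to at most $d$ members of $\mathcal{H}$. *)

(* Defs.v *)
From HB Require Import structures.
From mathcomp Require Import all_boot.
Set Implicit Arguments.
Unset Strict Implicit.
Unset Printing Implicit Defensive.

Record sgraph := SGraph {
  vertex :> finType;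
  adj : rel vertex;
  adj_sym : symmetric adj;
  adj_irrefl : irreflexive adj }.

Definition edges (G : sgraph) : {set {set G}} :=
  [set [set x; y] | x in G, y in G & adj x y].

Definition complete_bipartite (G : sgraph) : Prop :=
  exists A : {set G},
    [/\ A != set0, ~: A != set0
      & forall x y : G, adj x y = (x \in A) (+) (y \in A)].

Definition edge_cover (G : sgraph) (H : {set {set G}}) : bool :=
  [forall e in edges G, [exists A in H, e \subset A]].

Definition minimal_edge_cover (G : sgraph) (H : {set {set G}}) : bool :=
  minset (@edge_cover G) H.

(* "Degree d" is an upper bound: it need not be attained. *)
Definition has_degree (G : sgraph) (d : nat) (H : {set {set G}}) : Prop :=
  forall x : G, #|[set A in H | x \in A]| <= d.

(* b = b(d), the maximum number of members of a minimal edge cover of degree d of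
   a complete bipartite graph. *)
Definition is_b (d b : nat) : Prop :=
  (exists (G : sgraph) (H : {set {set G}}),
    [/\ complete_bipartite G, minimal_edge_cover H, has_degree d H
      & #|H| = b]) /\
  (forall (G : sgraph) (H : {set {set G}}),
    complete_bipartite G -> minimal_edge_cover H -> has_degree d H ->
    #|H| <= b).

(* Main.v *)
Require Import Defs.
From HB Require Import structures.
From mathcomp Require Import all_boot all_order all_algebra.
From mathcomp Require Import ring zify.
From Stdlib Require Import Classical_Prop.
Import Order.TTheory GRing.Theory Num.Theory.
Set Implicit Arguments.
Unset Strict Implicit.
Unset Printing Implicit Defensive.

(** Sending a vertex x to the set of members of H containing x turns the problem
into one on two cross-intersecting families P and Q of sets of size at most d
(one for each side) such that every member of H is the only common element of
some p in P and q in Q.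

Upper bound. A minimal subfamily R of P still isolating every element gives,
for each p in R, a set B p = q minus the element isolated only by p, such that
p meets B r exactly when r <> p. By Bollobas's inequality R has at most
C = 'C(2d - 1, d) members. If D is a maximal packing of disjoint d-sets in R,
every member of R outside D brings at most d - 1 elements outside the union of D,
so |H| <= (d - 1)|R| + |D|. A member of Q meets all of D, hence |D| <= d; and if
|D| >= 2 then |R| < C, since equality in Bollobas's inequality confines all
members of R to a set of 2d - 1 elements.

Lower bound. From a system on n elements one gets a system of degree d + 1 on
2n + 2 elements: take two copies, and two new elements e_0, e_1; add e_c to the
sets of P in copy c, and e_(1-c) to the sets of Q in copy c. *)

(** * Bollobas's inequality by averaging *)

Definition bollobas (T : finType) (P : {set {set T}}) (B : {set T} -> {set T}) :=
  {in P &, forall p q, (p :&: B q == set0) = (p == q)}.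

(* The weight of p is the probability that p precedes B p in a random order of V.
   Averaging over the last element x of the order reduces V to V :\ x; this is
   how lubell V <= 1 is proved, and how equality is passed on to subsets of V. *)
Definition lubell (T : finType) (P : {set {set T}}) (B : {set T} -> {set T})
    (V : {set T}) : rat :=
  (\sum_(p in P | p \subset V) ('C(#|p| + #|B p :&: V|, #|p|))%:R^-1)%R.

Lemma inv_bin_pred (a b : nat) : 0 < b ->
  (('C(a + b.-1, a))%:R^-1 *+ b = ('C(a + b, a))%:R^-1 *+ (a + b) :> rat)%R.
Proof.
case: b => // b _ /=.
have /(congr1 (fun n => n%:R : rat)%R) := mul_bin_down (a + b.+1) a.
rewrite addnS /= -addnS addKn !natrM => E.
have n0 m : a <= m -> ('C(m, a)%:R != 0 :> rat)%R by move=> ?; rewrite pnatr_eq0 -lt0n bin_gt0.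
rewrite -!(mulr_natr (_^-1)%R); apply: (mulfI (n0 (a + b) (leq_addr _ _))).
apply: (mulfI (n0 (a + b.+1) (leq_addr _ _))).
have := n0 (a + b) (leq_addr _ _); have := n0 (a + b.+1) (leq_addr _ _).
move: E; move: ('C(a + b, a)%:R%R) ('C(a + b.+1, a)%:R%R) => u v E v0 u0.
transitivity (b.+1%:R * v)%R; first by field.
by rewrite -E; field.
Qed.

(** Fix p inside V, with a = |p| and b = |B p :&: V| > 0. Deleting x kills the term of p if x is in
    p, lowers b by one if x is in [B p], and otherwise changes nothing; by [inv_bin_pred] these
    contributions add up to |V| times the weight of p. *)
Lemma lubell_average (T : finType) (P : {set {set T}}) (B : {set T} -> {set T}) (V : {set T}) :
  bollobas P B -> {in P, forall p : {set T}, p \subset V -> B p :&: V != set0} ->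
  (\sum_(x in V) lubell P B (V :\ x) = lubell P B V *+ #|V|)%R.
Proof.
move=> bolP nd; rewrite /lubell.
rewrite (exchange_big_dep (fun p => (p \in P) && (p \subset V))) /=; last first.
  by move=> x p xV; rewrite subsetD1 => /and3P[-> ->].
rewrite -sumrMnl; apply: eq_bigr => p /andP[pP pV].
have pB : [disjoint p & B p] by rewrite -setI_eq0 bolP.
rewrite (bigID (mem (B p))) /=.
set w := fun b => (('C(#|p| + b, #|p|))%:R^-1 : rat)%R.
have E1 : (\sum_(x | [&& x \in V, p \in P & p \subset V :\ x] && (x \in B p))
   w #|B p :&: (V :\ x)| = w #|B p :&: V|.-1 *+ #|B p :&: V|)%R.
  rewrite -sumr_const; apply: eq_big => x.
    rewrite subsetD1 pP pV inE /=; case xB: (x \in B p); rewrite ?andbF //.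
    by rewrite (disjointFl pB xB) !andbT.
  case/andP=> /andP[xV _] xB.
  by rewrite (cardsD1 x (B p :&: V)) inE xB xV /= setIDA.
have E2 : (\sum_(x | [&& x \in V, p \in P & p \subset V :\ x] && (x \notin B p))
   w #|B p :&: (V :\ x)| = w #|B p :&: V| *+ #|V :\: (p :|: B p)|)%R.
  rewrite -sumr_const; apply: eq_big => x.
    by rewrite subsetD1 pP pV !inE /= negb_or; case: (x \in V); case: (x \in p); case: (x \in B p).
  case/andP=> /andP[xV _] xB; congr (w #|pred_of_set _|); apply/setP=> y; rewrite !inE.
  by case: eqVneq => // ->; rewrite (negPf xB).
rewrite [X in (X + _)%R]E1 [X in (_ + X)%R]E2 {E1 E2} /w.
rewrite inv_bin_pred ?card_gt0 ?nd // -mulrnDr; congr (_ *+ _)%R.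
rewrite -(cardsID (p :|: B p) V) setIUr cardsU (setIidPr pV) (setIC V).
rewrite [X in _ - X](_ : _ = 0) ?subn0 //.
by apply: eq_card0 => x; rewrite !inE; case xp: (x \in p); rewrite //= (disjointFr pB xp).
Qed.

(** Any member of P inside V misses [B p], hence is p itself, which then has weight 1. *)
Lemma lubell_degenerate (T : finType) (P : {set {set T}}) (B : {set T} -> {set T}) (V p : {set T}) :
  bollobas P B -> p \in P -> p \subset V -> B p :&: V = set0 -> lubell P B V = 1%R.
Proof.
move=> bolP pP pV Bp0; rewrite /lubell (big_pred1 p) => [|q].
  by rewrite Bp0 cards0 addn0 binn invr1.
apply/idP/eqP => [/andP[qP qV]|->]; last by rewrite pP pV.
apply/eqP; rewrite -bolP // -subset0 -Bp0 subsetI subsetIr.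
by apply: subset_trans (subsetIl _ _) qV.
Qed.

Lemma lubell_le1 (T : finType) (P : {set {set T}}) (B : {set T} -> {set T}) (V : {set T}) :
  bollobas P B -> (lubell P B V <= 1)%R.
Proof.
move=> bolP; have [n] := ubnP #|V|; elim: n V => // n IHn V ltVn.
have [/existsP[p /and3P[pP pV /eqP Bp0]]|/existsPn nd] :=
  boolP [exists p, [&& p \in P, p \subset V & B p :&: V == set0]].
  by rewrite (lubell_degenerate bolP pP pV Bp0).
have nd' : {in P, forall p : {set T}, p \subset V -> B p :&: V != set0}.
  by move=> p pP pV; have := nd p; rewrite pP pV.
have [V0 | Vn0] := eqVneq V set0.
  rewrite /lubell big1 // => p /andP[pP pV].
  by have := nd' p pP pV; rewrite V0 setI0 eqxx.
have V0 : (0 < #|V|%:R :> rat)%R by rewrite ltr0n card_gt0.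
rewrite -(ler_pM2r V0) mul1r mulr_natr -lubell_average //.
have <- : (\sum_(x in V) 1 = #|V|%:R :> rat)%R by rewrite sumr_const.
apply: ler_sum => x xV; apply: IHn.
by rewrite (cardsD1 x) xV in ltVn.
Qed.

(** An average of numbers at most 1 equals 1 only if each of them does. *)
Lemma lubell_eq1_D1 (T : finType) (P : {set {set T}}) (B : {set T} -> {set T})
    (V : {set T}) x :
  bollobas P B -> lubell P B V = 1%R ->
  {in P, forall p, B p :&: V != set0} -> lubell P B (V :\ x) = 1%R.
Proof.
move=> bolP V1 nd; have [xV|xV] := boolP (x \in V); last first.
  suff -> : V :\ x = V by [].
  by apply/setP=> y; rewrite !inE; case: eqVneq => // ->; rewrite (negPf xV).
apply/eqP; rewrite eq_le lubell_le1 //= leNgt; apply/negP=> lt1.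
suff : (lubell P B V *+ #|V| < #|V|%:R)%R by rewrite V1 ltxx.
rewrite -lubell_average //; last by move=> p pP _; apply: nd.
have <- : (\sum_(y in V) 1 = #|V|%:R :> rat)%R by rewrite sumr_const.
rewrite (bigD1 x) //= [ltRHS](bigD1 x) //= ltr_leD //.
by apply: ler_sum => y _; apply: lubell_le1.
Qed.

(** The points of V outside Y are deleted one by one; every intermediate set contains Y, so it still
    meets every [B p]. *)
Lemma lubell_eq1_sub (T : finType) (P : {set {set T}}) (B : {set T} -> {set T})
    (V Y : {set T}) :
  bollobas P B -> lubell P B V = 1%R -> Y \subset V ->
  {in P, forall p, B p :&: Y != set0} -> lubell P B Y = 1%R.
Proof.
move=> bolP V1 YV nd; have [n] := ubnP #|V :\: Y|; elim: n V V1 YV => // n IHn V V1 YV ltn.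
have [V0|[x]] := set_0Vmem (V :\: Y).
  suff -> : Y = V by [].
  by apply/eqP; rewrite eqEsubset YV -setD_eq0 V0 eqxx.
rewrite inE => /andP[xY xV]; apply: (IHn (V :\ x)).
- apply: lubell_eq1_D1 => // p pP; apply: contraNneq (nd p pP) => V0.
  by rewrite -subset0 -V0 setIS.
- by rewrite subsetD1 YV xY.
- move: ltn; rewrite (cardsD1 x) inE xV xY /= add1n ltnS; apply: leq_trans.
  by rewrite ltnS subset_leq_card //; apply/subsetP=> y; rewrite !inE andbCA.
Qed.

Lemma lubell_eq1_ex (T : finType) (P : {set {set T}}) (B : {set T} -> {set T}) (V : {set T}) :
  lubell P B V = 1%R -> exists2 p, p \in P & p \subset V.
Proof.
have [/existsP[p /andP[pP pV]]|/existsPn no] := boolP [exists p in P, p \subset V].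
  by exists p.
by rewrite /lubell big_pred0 // => p; apply/negbTE; apply: no.
Qed.

(** * Cardinality bound and the case of equality *)

Lemma leq_bin2 (a b c e : nat) : a <= c -> b <= e -> 'C(a + b, a) <= 'C(c + e, c).
Proof.
move=> ac be; apply: (@leq_trans 'C(a + e, a)).
  by apply: leq_bin2l; rewrite leq_add2l.
rewrite -(bin_sub (leq_addr _ _)) -[leqRHS](bin_sub (leq_addr _ _)) !addKn.
by apply: leq_bin2l; rewrite leq_add2r.
Qed.

(** By monotonicity of binomials each weight is at least the inverse of 'C(2d - 1, d), so a sum as
    small as the bound makes every term tight. *)
Lemma lubell_lower (T : finType) (P : {set {set T}}) (B : {set T} -> {set T}) (d : nat) :
  {in P, forall p : {set T}, #|p| <= d /\ #|B p| <= d.-1} ->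
  (#|P|%:R / ('C(d + d.-1, d))%:R <= lubell P B setT)%R /\
  (lubell P B setT <= #|P|%:R / ('C(d + d.-1, d))%:R ->
   {in P, forall p : {set T}, 'C(#|p| + #|B p|, #|p|) = 'C(d + d.-1, d)})%R.
Proof.
move=> sz; have C0 a b : (0 < 'C(a + b, a)%:R :> rat)%R by rewrite ltr0n bin_gt0 leq_addr.
have le p : p \in P -> (('C(d + d.-1, d))%:R^-1 <= ('C(#|p| + #|B p|, #|p|))%:R^-1 :> rat)%R.
  by move=> /sz[? ?]; rewrite lef_pV2 ?posrE // ler_nat leq_bin2.
have -> : lubell P B setT = (\sum_(p in P) ('C(#|p| + #|B p|, #|p|))%:R^-1)%R.
  by apply: eq_big => [p|p _]; rewrite ?subsetT ?andbT // setIT.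
rewrite mulrC mulr_natr -sumr_const; split; first exact: ler_sum.
move=> ge p pP; apply/eqP; rewrite eqn_leq; have [? ?] := sz p pP.
rewrite leq_bin2 //= leqNgt; apply/negP=> lt; move: ge; apply/negP; rewrite -ltNge.
rewrite (bigD1 p) //= [ltRHS](bigD1 p) //= ltr_leD //.
  by rewrite ltf_pV2 ?posrE // ltr_nat.
by apply: ler_sum => q /andP[qP _]; apply: le.
Qed.

Lemma bollobas_card (T : finType) (P : {set {set T}}) (B : {set T} -> {set T}) (d : nat) :
  bollobas P B -> {in P, forall p : {set T}, #|p| <= d /\ #|B p| <= d.-1} ->
  #|P| <= 'C(d + d.-1, d).
Proof.
move=> bolP sz; have [le _] := lubell_lower sz.
have C0 : (0 < 'C(d + d.-1, d)%:R :> rat)%R by rewrite ltr0n bin_gt0 leq_addr.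
by move: (le_trans le (lubell_le1 _ bolP)); rewrite ler_pdivrMr // mul1r ler_nat.
Qed.
(* In terms of orders, equality says that in every order some q precedes B q.
   The order p :\ x, y, x, ... forces q = y |: p :\ x, and the order
   ..., y, x, B p :\ y forces B q = x |: B p :\ y. *)
Lemma bollobas_exchange (T : finType) (P : {set {set T}}) (B : {set T} -> {set T})
    (a b : nat) (p : {set T}) (x y : T) :
  bollobas P B -> {in P, forall q : {set T}, #|q| = a /\ #|B q| = b} ->
  lubell P B setT = 1%R -> p \in P -> x \in p -> y \in B p ->
  exists q, [/\ q \in P, q = y |: p :\ x & B q = x |: B p :\ y].
Proof.
move=> bolP sz lub1 pP xp yB.
have pB : [disjoint p & B p] by rewrite -setI_eq0 bolP.
have xB := disjointFr pB xp; have yp := disjointFl pB yB.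
have [q qP qE] : exists2 q, q \in P & q = y |: p :\ x.
  (* Weight one passes to y |: p and, after one more deletion, to (y |: p) :\ x. Some member of P
     lies inside this set, and sizes force equality. *)
  have nd : {in P, forall q, B q :&: (y |: p) != set0}.
    move=> q qP; have [->|qp] := eqVneq q p.
      by apply/set0Pn; exists y; rewrite !inE yB eqxx.
    have /set0Pn[z] : p :&: B q != set0 by rewrite bolP // eq_sym.
    by rewrite inE => /andP[zp zB]; apply/set0Pn; exists z; rewrite !inE zp zB orbT.
  have L1 := lubell_eq1_sub bolP lub1 (subsetT _) nd.
  have [q qP qsub] := lubell_eq1_ex (lubell_eq1_D1 x bolP L1 nd).
  exists q => //; apply/eqP; rewrite eqEcard; apply/andP; split.
    by apply: subset_trans qsub _; apply/subsetP=> z; rewrite !inE; case: (z == y); rewrite ?andbF.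
  by rewrite (sz q qP).1 -(sz p pP).1 cardsU1 !inE yp andbF (cardsD1 x p) xp.
have [l lP lE] : exists2 l, l \in P & B l = x |: B p :\ y.
  (* [B r] has one element more than B p :\ y, so it always meets Z. *)
  set Z := ~: (B p :\ y).
  have nd : {in P, forall r, B r :&: Z != set0}.
    move=> r rP; rewrite setI_eq0 -subsets_disjoint; apply/negP=> /subset_leq_card.
    by have := cardsD1 y (B p); rewrite yB (sz p pP).2 (sz r rP).2 => ->; rewrite ltnn.
  have L1 := lubell_eq1_D1 x bolP (lubell_eq1_sub bolP lub1 (subsetT _) nd) nd.
  have [/existsP[l /andP[lP]]|/existsPn no] := boolP [exists l in P, B l :&: (Z :\ x) == set0].
    rewrite setI_eq0 -[Z :\ x]setCK -subsets_disjoint setCD setCK => sub.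
    exists l => //; apply/eqP; rewrite eqEcard setUC sub setUC cardsU1 !inE xB andbF.
    by rewrite (sz l lP).2 -(sz p pP).2 (cardsD1 y (B p)) yB leqnn.
  (* If no [B l] missed Z :\ x, then y could be deleted too; some r in P avoiding x would miss
     [B p], hence be p, which contains x. *)
  have nd' : {in P, forall r, B r :&: (Z :\ x) != set0}.
    by move=> r rP; have := no r; rewrite rP.
  have [r rP] := lubell_eq1_ex (lubell_eq1_D1 y bolP L1 nd').
  rewrite !subsetD1 => /andP[/andP[rZ xr] yr]; case/negP: xr.
  suff /eqP -> : r == p by [].
  rewrite -bolP //; apply/eqP/setP=> z; rewrite !inE; case zr: (z \in r) => //=.
  have := subsetP rZ z zr; rewrite !inE.
  by case: (eqVneq z y) zr => [-> /(negP yr)|_ _ /negPf].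
exists q; split=> //; suff /eqP -> : q == l by [].
rewrite -bolP // qE lE -subset0; apply/subsetP=> z; rewrite !inE.
case: (eqVneq z y) => [->|zy] /=; first by rewrite orbF; case: eqVneq xB yB => // -> ->.
by case: (eqVneq z x) => //= zx; case zp: (z \in p) => //=; rewrite (disjointFr pB zp).
Qed.

(** Induction on |p :\: q|: exchanging x in p :\: q for y in q :&: B p brings p closer to q and
    leaves p :|: B p unchanged. *)
Lemma bollobas_equality_support (T : finType) (P : {set {set T}}) (B : {set T} -> {set T})
    (a b : nat) (p q : {set T}) :
  bollobas P B -> {in P, forall r : {set T}, #|r| = a /\ #|B r| = b} ->
  lubell P B setT = 1%R -> p \in P -> q \in P -> q \subset p :|: B p.
Proof.
move=> bolP sz lub1 + qP; have [n] := ubnP #|p :\: q|.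
elim: n p => // n IHn p ltn pP.
have [<-|pq] := eqVneq p q; first exact: subsetUl.
have [x xp xq] : exists2 x, x \in p & x \notin q.
  apply/subsetPn; apply: contra pq => pq.
  by rewrite eqEcard pq (sz p pP).1 (sz q qP).1 leqnn.
have /set0Pn[y] : q :&: B p != set0 by rewrite bolP // eq_sym.
rewrite inE => /andP[yq yB].
have [r [rP rE BrE]] := bollobas_exchange bolP sz lub1 pP xp yB.
have -> : p :|: B p = r :|: B r.
  by rewrite BrE rE setUACA (setUC [set y]) setUACA (setD1K xp) (setD1K yB).
apply: IHn => //; move: ltn; rewrite (cardsD1 x) !inE xp xq /= add1n ltnS; apply: leq_trans.
rewrite ltnS subset_leq_card //; apply/subsetP=> z; rewrite rE !inE.
by case: (eqVneq z y) => [->|_] /=; rewrite ?yq // andbCA.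
Qed.

(** Equality would force the exact sizes d and d - 1, and so put the 2d elements of p :|: q into p
    :|: B p, which has only 2d - 1. *)
Lemma bollobas_card_lt (T : finType) (P : {set {set T}}) (B : {set T} -> {set T}) (d : nat)
    (p q : {set T}) :
  bollobas P B -> {in P, forall p : {set T}, #|p| <= d /\ #|B p| <= d.-1} -> 1 < d ->
  p \in P -> q \in P -> [disjoint p & q] -> #|P| < 'C(d + d.-1, d).
Proof.
move=> bolP sz d1 pP qP pq; rewrite ltn_neqAle (bollobas_card bolP sz) andbT.
apply/eqP=> cP; have [le eqb] := lubell_lower sz.
have C0 : ('C(d + d.-1, d)%:R != 0 :> rat)%R by rewrite pnatr_eq0 -lt0n bin_gt0 leq_addr.
rewrite cP divff // in le eqb; have {}eqb := eqb (lubell_le1 _ bolP).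
have lub1 : lubell P B setT = 1%R by apply/eqP; rewrite eq_le le lubell_le1.
have szE : {in P, forall p : {set T}, #|p| = d /\ #|B p| = d.-1}.
  move=> r rP; have [rd Bd] := sz r rP; have := eqb r rP.
  case: d d1 rd Bd {sz eqb le C0 cP} => [|[|d]] //= _ rd Bd E.
  (* Pascal's rule with two positive summands, available since d > 1: lowering either size strictly
     lowers the binomial. *)
  have binE : 'C(d.+2 + d.+1, d.+2) = 'C(d.+2 + d, d.+2) + 'C(d.+1 + d.+1, d.+1).
    by rewrite addnS binS (addSnnS d.+1 d).
  split; apply/eqP; rewrite eqn_leq ?rd ?Bd /= leqNgt; apply/negP; rewrite ltnS => lt.
    have := leq_bin2 lt Bd; rewrite E binE leqNgt -{1}[_ d.+1]add0n ltn_add2r.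
    by rewrite bin_gt0 leq_addr.
  have := leq_bin2 rd lt; rewrite E binE leqNgt -{1}['C(d.+2 + d, _)]addn0 ltn_add2l.
  by rewrite bin_gt0 leq_addr.
have sub := bollobas_equality_support bolP szE lub1 pP qP.
have : #|p :|: q| <= #|p :|: B p| by rewrite subset_leq_card // subUset subsetUl.
have pB : p :&: B p = set0 by apply/eqP; rewrite bolP.
have pq0 : p :&: q = set0 by apply/eqP; rewrite setI_eq0.
rewrite !cardsU pB pq0 cards0 !subn0 (szE p pP).1 (szE p pP).2 (szE q qP).1 leq_add2l.
by case: d d1 {sz cP eqb C0 le szE} => //= d _; rewrite ltnn.
Qed.

(** * Bounding the number of isolated elements *)

(** In a minimal isolating subfamily R, deleting p leaves some v no longer isolated, where p :&: q =
    [set v] with q in Q; take q :\ v for [B p]. Any other r in R meets q, but not in v alone, so it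
    meets [B p]. *)
Lemma exact_cover_bollobas (T : finType) (V : {set T}) (P Q : {set {set T}}) (d : nat) :
  {in Q, forall q : {set T}, #|q| <= d} ->
  {in P & Q, forall p q, p :&: q != set0} ->
  {in V, forall v, exists p q, [/\ p \in P, q \in Q & p :&: q = [set v]]} ->
  exists (P' : {set {set T}}) (B : {set T} -> {set T}),
    [/\ P' \subset P, V \subset cover P', bollobas P' B
      & {in P', forall p, #|B p| <= d.-1}].
Proof.
move=> Qd PQ PV.
pose covers (R : {set {set T}}) :=
  [forall v in V, exists p in R, exists q in Q, p :&: q == [set v]].
have coversP (R : {set {set T}}) : reflect {in V, forall v, exists p q, [/\ p \in R, q \in Q & p :&: q = [set v]]}
    (covers R).
  apply: (iffP forall_inP) => cR v vV.
    by have /exists_inP[p pR /exists_inP[q qQ /eqP]] := cR v vV; exists p, q.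
  have [p [q [pR qQ pq]]] := cR v vV.
  by apply/exists_inP; exists p => //; apply/exists_inP; exists q => //; apply/eqP.
have [R minR RP] := minset_exists (introT (coversP P) PV).
have [/coversP cR Rmin] := minsetP minR.
pose good p b := [&& p :&: b == set0, #|b| <= d.-1 & [forall r in R, (r != p) ==> (r :&: b != set0)]].
have ex_good p : p \in R -> exists b, good p b.
  move=> pR.
  have : ~~ covers (R :\ p).
    by apply/negP=> /Rmin/(_ (subsetDl _ _))/setP/(_ p); rewrite !inE eqxx pR.
  case/forall_inPn=> v vV /exists_inPn no.
  have [p' [q [p'R qQ p'q]]] := cR v vV.
  have p'p : p' = p.
    apply/eqP/negPn/negP=> p'p; have p'D : p' \in R :\ p by rewrite !inE p'p.
    by have /exists_inPn/(_ q qQ) := no p' p'D; rewrite p'q eqxx.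
  exists (q :\ v); apply/and3P; split.
  - by rewrite setIDA -p'p p'q setDv.
  - have : v \in q by have /setP/(_ v) := p'q; rewrite !inE eqxx => /andP[].
    by move=> vq; have := Qd q qQ; rewrite (cardsD1 v) vq; case: (d).
  - apply/forall_inP=> r rR; apply/implyP=> rp; apply/eqP=> r0.
    have rD : r \in R :\ p by rewrite !inE rp.
    have /exists_inPn/(_ q qQ)/negP := no r rD; apply.
    rewrite eqEcard cards1 card_gt0 PQ ?(subsetP RP) // andbT.
    by rewrite -setD_eq0 -setIDA r0.
pose B p := odflt set0 [pick b | good p b].
have BP p : p \in R -> good p (B p).
  by move=> /ex_good[b gb]; rewrite /B; case: pickP => [//|/(_ b)]; rewrite gb.
exists R, B; split=> //.
- apply/subsetP=> v vV; have [p [q [pR _ pq]]] := cR v vV.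
  apply/bigcupP; exists p => //.
  by have /setP/(_ v) := pq; rewrite !inE eqxx => /andP[].
- move=> p q pR qR; have [<-|pq] := eqVneq p q; first by have /and3P[-> _ _] := BP p pR.
  have /and3P[_ _ /forall_inP/(_ p pR)] := BP q qR.
  by rewrite pq => /negPf.
- by move=> p /BP /and3P[].
Qed.

(** By maximality of the packing D, a d-set outside D meets [cover D], so each member of P :\: D
    adds at most d - 1 elements; each member of D adds d = (d - 1) + 1. *)
Lemma card_cover_disjoint (T : finType) (P : {set {set T}}) (d : nat) : 0 < d ->
  {in P, forall p : {set T}, #|p| <= d} ->
  exists D : {set {set T}}, [/\ D \subset P, trivIset D,
    {in D, forall p : {set T}, #|p| = d} & #|cover P| <= d.-1 * #|P| + #|D|].
Proof.
move=> d0 Pd.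
pose packing (D : {set {set T}}) :=
  [&& D \subset P, trivIset D & [forall p in D, #|p : {set T}| == d]].
have pack0 : packing set0.
  rewrite /packing sub0set /trivIset /cover !big_set0 cards0 eqxx.
  by apply/forall_inP=> p; rewrite inE.
have [D maxD _] := maxset_exists pack0.
have [/and3P[DP tD /forall_inP Dd] Dmax] := maxsetP maxD.
exists D; split=> // [p /Dd/eqP //|].
have small p : p \in P :\: D -> #|p :\: cover D| <= d.-1.
  rewrite inE => /andP[pD pP]; rewrite -ltnS prednK // ltn_neqAle.
  rewrite (leq_trans (subset_leq_card (subsetDl _ _))) ?Pd // andbT.
  apply: contra pD => /eqP cp.
  have pd : #|p| = d.
    by apply/eqP; rewrite eqn_leq Pd // -cp subset_leq_card // subsetDl.
  have dis : [disjoint p & cover D].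
    by rewrite -setI_eq0 -cards_eq0 -(eqn_add2r d) -{1}cp cardsID pd.
  suff /Dmax/(_ (subsetUr _ _)) <- : packing (p |: D) by rewrite setU11.
  apply/and3P; split; first by rewrite subUset sub1set pP.
    apply/trivIsetP=> r s; rewrite !inE.
    have disp r' : r' \in D -> [disjoint p & r'].
      by move=> rD; apply: disjointWr dis; apply: bigcup_sup.
    case/orP=> [/eqP-> | rD] /orP[/eqP-> | sD] rs.
    - by rewrite eqxx in rs.
    - exact: disp.
    - by rewrite disjoint_sym disp.
    - exact: (trivIsetP tD).
  by apply/forall_inP=> r; rewrite !inE => /orP[/eqP->|/Dd //]; apply/eqP.
have subc : cover P \subset cover D :|: \bigcup_(p in P :\: D) (p :\: cover D).
  apply/subsetP=> x /bigcupP[p pP xp]; rewrite inE; case: (boolP (x \in cover D)) => //= xD.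
  apply/bigcupP; exists p; rewrite !inE ?pP ?xD ?xp // andbT.
  by apply: contra xD => pD; apply/bigcupP; exists p.
apply: leq_trans (subset_leq_card subc) _; apply: leq_trans (leq_card_setU _ _) _.
have -> : #|cover D| = #|D| * d.
  by rewrite -(eqP tD) -sum_nat_const; apply: eq_bigr => p /Dd/eqP.
have : #|\bigcup_(p in P :\: D) (p :\: cover D)| <= #|P :\: D| * d.-1.
  rewrite -sum_nat_const.
  elim/big_rec2: _ => [|p n U pPD IH]; first by rewrite cards0.
  by apply: leq_trans (leq_card_setU _ _) _; apply: leq_add (small p pPD) IH.
move=> le; apply: leq_trans (leq_add (leqnn _) le) _.
rewrite -(cardsID D P) (setIidPr DP) mulnDr -[X in _ * X + _](prednK d0) mulnS.
by rewrite -addnA addnC !(mulnC d.-1).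
Qed.

Lemma card_trivIset_transversal (T : finType) (D : {set {set T}}) (q : {set T}) :
  trivIset D -> {in D, forall p, p :&: q != set0} -> #|D| <= #|q|.
Proof.
move=> tD Dq; have [->|[p0 p0D]] := set_0Vmem D; first by rewrite cards0.
have [x0 _] := set0Pn _ (Dq p0 p0D).
pose f (p : {set T}) := odflt x0 [pick x in p :&: q].
have fP p : p \in D -> f p \in p :&: q.
  move=> pD; rewrite /f; case: pickP => // no; have /set0Pn[x] := Dq p pD.
  by rewrite no.
rewrite -(card_in_imset (f := f)).
  by apply/subset_leq_card/subsetP=> x /imsetP[p /fP]; rewrite inE => /andP[_ fq] ->.
move=> p r pD rD fpr; apply/eqP/negPn/negP=> pr.
have /trivIsetP/(_ p r pD rD pr) := tD.
have := fP p pD; have := fP r rD; rewrite -fpr !inE => /andP[fr _] /andP[fp _] pr0.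
by have := disjointFr pr0 fp; rewrite fr.
Qed.

Lemma exact_cover_card (T : finType) (V : {set T}) (P Q : {set {set T}}) (d : nat) : 0 < d ->
  {in P, forall p : {set T}, #|p| <= d} -> {in Q, forall q : {set T}, #|q| <= d} ->
  {in P & Q, forall p q, p :&: q != set0} ->
  {in V, forall v, exists p q, [/\ p \in P, q \in Q & p :&: q = [set v]]} ->
  #|V| <= d.-1 * 'C(d + d.-1, d) + 1.
Proof.
move=> d0 Pd Qd PQ PV; have [->|[v0 v0V]] := set_0Vmem V; first by rewrite cards0.
have [_ [q0 [_ q0Q _]]] := PV v0 v0V.
have [R [B [RP VR bolR Bd]]] := exact_cover_bollobas Qd PQ PV.
have Rd : {in R, forall p : {set T}, #|p| <= d} by move=> p /(subsetP RP)/Pd.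
have sz : {in R, forall p : {set T}, #|p| <= d /\ #|B p| <= d.-1}.
  by move=> p pR; split; [apply: Rd | apply: Bd].
have [D [DR tD Dd leR]] := card_cover_disjoint d0 Rd.
apply: leq_trans (subset_leq_card VR) _; apply: leq_trans leR _.
have leC := bollobas_card bolR sz.
have [D1|D1] := leqP #|D| 1; first by rewrite leq_add // leq_mul2l leC orbT.
have Dd' : #|D| <= d.
  apply: leq_trans (Qd q0 q0Q); apply: card_trivIset_transversal => // p pD.
  by apply: PQ => //; apply: subsetP RP _ (subsetP DR _ pD).
have /card_gt1P[p [q [pD qD pq]]] := D1.
have := bollobas_card_lt bolR sz (leq_trans D1 Dd') (subsetP DR _ pD) (subsetP DR _ qD)
  (trivIsetP tD p q pD qD pq).
(* With C = 'C(2d - 1, d), |R| <= C - 1 and |D| <= d: indeed (d - 1)(C - 1) + d = (d - 1)C + 1. *)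
move=> ltC; have := leq_mul (leqnn d.-1) ltC; rewrite mulnS => le.
apply: leq_trans (leq_add le (leqnn 1)); rewrite (addnC d.-1) -addnA leq_add2l.
by rewrite addn1 prednK.
Qed.

(** * From edge covers to set systems *)

Lemma edgesP (G : sgraph) (e : {set G}) :
  reflect (exists x y : G, adj x y /\ e = [set x; y]) (e \in edges G).
Proof.
apply: (iffP imset2P) => [[x y _] | [x [y [xy ->]]]]; last by exists x y; rewrite ?inE.
by rewrite inE => /andP[_ xy] ->; exists x, y.
Qed.

(** The ground set is H itself. Covering an edge xy means that [S x] meets [S y]; by minimality each
    X in H is the only member containing some edge xy, so [S x] and [S y] share X alone. *)
Lemma minimal_edge_cover_card (G : sgraph) (H : {set {set G}}) (d : nat) : 0 < d ->
  complete_bipartite G -> minimal_edge_cover H -> has_degree d H ->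
  #|H| <= d.-1 * 'C(d + d.-1, d) + 1.
Proof.
move=> d0 [A [_ _ adjE]] minH degH; have [covH Hmin] := minsetP minH.
pose S (x : G) := [set X in H | x \in X].
apply: (@exact_cover_card _ _ (S @: A) (S @: ~: A)) => //.
- by move=> _ /imsetP[x _ ->]; apply: degH.
- by move=> _ /imsetP[x _ ->]; apply: degH.
- move=> _ _ /imsetP[x xA ->] /imsetP[y yA ->].
  have xy : adj x y by rewrite adjE xA; rewrite inE in yA; rewrite (negPf yA).
  have /forall_inP/(_ [set x; y]) := covH.
  have -> : [set x; y] \in edges G by apply/edgesP; exists x, y.
  move=> /(_ isT)/exists_inP[X XH]; rewrite subUset !sub1set => /andP[xX yX].
  by apply/set0Pn; exists X; rewrite !inE XH xX yX.
move=> X XH.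
have : ~~ edge_cover (H :\ X).
  by apply/negP=> /Hmin/(_ (subsetDl _ _))/setP/(_ X); rewrite !inE eqxx XH.
case/forall_inPn=> e eE /exists_inPn no.
have {eE} [x [y [xA yA eE]]] : exists x y, [/\ x \in A, y \notin A & e = [set x; y]].
  have /edgesP[x [y [xy ->]]] := eE; move: xy; rewrite adjE.
  have [xA|xA] := boolP (x \in A) => /= yA; first by exists x, y.
  by exists y, x; rewrite setUC.
have onlyX Y : Y \in H -> e \subset Y -> Y = X.
  move=> YH; apply: contraTeq => YX; apply: no; by rewrite !inE YX.
exists (S x), (S y); split; [exact: imset_f | by apply: imset_f; rewrite inE | ].
apply/setP=> Y; rewrite !inE; apply/idP/eqP=> [/andP[/andP[YH xY] /andP[_ yY]]|->].
  by apply: onlyX => //; rewrite eE subUset !sub1set xY.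
have /forall_inP/(_ e) := covH.
have -> : e \in edges G by apply/edgesP; exists x, y; rewrite adjE xA (negPf yA).
move=> /(_ isT)/exists_inP[Z ZH eZ]; rewrite -(onlyX Z ZH eZ).
by move: eZ; rewrite ZH eE subUset !sub1set => /andP[-> ->].
Qed.

(** * From set systems to edge covers, and the doubling construction *)

(** An element of [I + J] tested as a boolean is true exactly on the left summand, so adjacency
    means lying on opposite sides. *)
Definition join_adj (I J : finType) : rel (I + J) :=
  fun x y => if x then ~~ y else y.

Lemma join_adj_sym (I J : finType) : symmetric (@join_adj I J).
Proof. by case=> ? []. Qed.

Lemma join_adj_irrefl (I J : finType) : irreflexive (@join_adj I J).
Proof. by case. Qed.

Definition join_graph (I J : finType) : sgraph :=
  SGraph (@join_adj_sym I J) (@join_adj_irrefl I J).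

(** An element v becomes the vertex set [h v] of the indices whose set contains v, so the edge ij
    lies in [h v] iff v is in s i :&: t j. The isolating pairs give both minimality of the cover and
    injectivity of [h]. *)
Lemma exact_cross_realization (T I J : finType) (s : I -> {set T}) (t : J -> {set T}) (d : nat)
    (i0 : I) (j0 : J) :
  (forall i, #|s i| <= d) -> (forall j, #|t j| <= d) ->
  (forall i j, s i :&: t j != set0) ->
  (forall v, exists i j, s i :&: t j = [set v]) ->
  exists (G : sgraph) (H : {set {set G}}),
    [/\ complete_bipartite G, minimal_edge_cover H, has_degree d H & #|H| = #|T|].
Proof.
move=> sd td st stv; exists (join_graph I J).
pose h (v : T) : {set join_graph I J} :=
  [set z : I + J | match z with inl i => v \in s i | inr j => v \in t j end].
have h_edge v i j : ([set inl i; inr j] \subset h v) = (v \in s i :&: t j).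
  by rewrite subUset !sub1set !inE.
have edgeE (e : {set join_graph I J}) : e \in edges (join_graph I J) ->
  exists i j, e = [set inl i; inr j].
  case/edgesP=> -[i|j] [[i'|j'] [//= _ ->]]; first by exists i, j'.
  by exists i', j; rewrite setUC.
have edgeI i j : [set inl i; inr j] \in edges (join_graph I J).
  by apply/edgesP; exists (inl i), (inr j).
exists (h @: setT); split.
- exists [set z : I + J | if z is inl _ then true else false]; split.
  + by apply/set0Pn; exists (inl i0); rewrite inE.
  + by apply/set0Pn; exists (inr j0); rewrite !inE.
  + by move=> [i|j] [i'|j']; rewrite !inE.
- apply/minsetP; split.
    apply/forall_inP=> e /edgeE[i [j ->]]; have /set0Pn[v vij] := st i j.
    by apply/exists_inP; exists (h v); rewrite ?imset_f // h_edge.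
  move=> H' /forall_inP covH' sub; apply/eqP; rewrite eqEsubset sub /=.
  apply/subsetP=> _ /imsetP[v _ ->]; have [i [j ijv]] := stv v.
  have /exists_inP[X XH] := covH' _ (edgeI i j).
  have /imsetP[w _ XE] := subsetP sub X XH.
  by rewrite XE h_edge ijv inE => /eqP <-; rewrite -XE.
- move=> x; pose S := match x with inl i => s i | inr j => t j end.
  have Sd : #|S| <= d by rewrite /S; case: (x).
  apply: leq_trans Sd; apply: leq_trans (leq_imset_card h _).
  apply/subset_leq_card/subsetP=> X; rewrite inE => /andP[/imsetP[v _ ->]].
  rewrite inE => xv; apply: imset_f; by rewrite /S; case: (x) xv.
- rewrite card_imset ?cardsT // => v w vw; have [i [j ijv]] := stv v.
  have : [set inl i; inr j] \subset h v by rewrite h_edge ijv inE.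
  by rewrite vw h_edge ijv inE => /eqP.
Qed.

(** The elements [inl (c, x)] form two copies of T; [inr false] and [inr true] are the two new
    elements. *)
Definition double_set (T : finType) (c e : bool) (A : {set T}) : {set bool * T + bool} :=
  inr e |: [set inl (c, x) | x in A].

Lemma in_double_set_l (T : finType) (c e : bool) (A : {set T}) b x :
  (inl (b, x) \in double_set c e A) = (b == c) && (x \in A).
Proof.
rewrite !inE /=; apply/imsetP/andP=> [[y yA [-> ->]]|[/eqP-> xA]]; first by rewrite eqxx.
by exists x.
Qed.

Lemma in_double_set_r (T : finType) (c e : bool) (A : {set T}) b :
  (inr b \in double_set c e A) = (b == e).
Proof.
rewrite !inE; suff /negPf-> : inr b \notin [set inl (c, x) | x in A] by rewrite orbF.
by apply/imsetP=> -[].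
Qed.

Lemma card_double_set (T : finType) (c e : bool) (A : {set T}) :
  #|double_set c e A| <= #|A|.+1.
Proof.
by rewrite cardsU1 -[_.+1]add1n leq_add ?leq_imset_card //; case: (_ \notin _).
Qed.

(** The index d stands for degree d + 1, starting from a single point. After doubling, sets from the
    same copy intersect as before, and sets from opposite copies share exactly one new element. The
    count is 2(3 * 2^d - 2) + 2 = 3 * 2^(d+1) - 2. *)
Lemma exact_cross_exists (d : nat) :
  exists (T I J : finType) (s : I -> {set T}) (t : J -> {set T}),
    [/\ #|T| = 3 * 2 ^ d - 2, inhabited I, inhabited J,
        (forall i, #|s i| <= d.+1) /\ (forall j, #|t j| <= d.+1)
      & (forall i j, s i :&: t j != set0) /\ (forall v, exists i j, s i :&: t j = [set v])].
Proof.
elim: d => [|d [T [I [J [s [t [cT [i0] [j0] [sd td] [st stv]]]]]]]].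
  exists unit, unit, unit, (fun=> setT), (fun=> setT); split.
  - by rewrite card_unit.
  - by split; exact: tt.
  - by split; exact: tt.
  - by split=> _; rewrite cardsT card_unit.
  - split=> [_ _|v]; first by apply/set0Pn; exists tt; rewrite !inE.
    by exists tt, tt; apply/setP=> -[]; rewrite !inE; case: v.
exists (bool * T + bool)%type, (bool * I)%type, (bool * J)%type.
exists (fun ci => double_set ci.1 ci.1 (s ci.2)), (fun cj => double_set cj.1 (~~ cj.1) (t cj.2)).
split.
- rewrite card_sum card_prod card_bool cT expnS; have : 0 < 2 ^ d by rewrite expn_gt0.
  by case: (2 ^ d) => // n _; lia.
- by split; exact: (true, i0).
- by split; exact: (true, j0).
- split=> [[c i]|[c j]]; apply: leq_trans (card_double_set _ _ _) _; rewrite ltnS.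
    exact: sd.
  exact: td.
split=> [[c i] [c' j]|[[c v]|c]] /=.
- have [<-|cc'] := eqVneq c c'; last first.
    by apply/set0Pn; exists (inr c); rewrite in_setI !in_double_set_r eqxx; case: c c' cc' => [] [].
  have /set0Pn[v vst] := st i j; apply/set0Pn; exists (inl (c, v)).
  by move: vst; rewrite !in_setI !in_double_set_l eqxx.
- have [i [j ijv]] := stv v; exists (c, i), (c, j); apply/setP=> -[[b w]|b].
    rewrite in_setI !in_double_set_l inE.
    rewrite -[RHS]/((b == c) && (w == v)) -(in_set1 w v) -ijv inE.
    by case: (b == c).
  by rewrite in_setI !in_double_set_r !inE; case: b c => [] [].
(* Any pair from the opposite copies c and ~~ c isolates the new element [inr c]. *)
- exists (c, i0), (~~ c, j0); apply/setP=> -[[b w]|b].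
    by rewrite in_setI !in_double_set_l !inE; case: b c => [] [] /=; rewrite ?andbF.
  by rewrite in_setI !in_double_set_r !inE; case: b c => [] [].
Qed.

(** * Existence of the maximum and conclusion *)

(** As [P] is an arbitrary predicate, excluded middle decides whether it holds beyond n; each larger
    witness shrinks N - n. *)
Lemma bounded_max_exists (P : nat -> Prop) (n N : nat) :
  P n -> (forall m, P m -> m <= N) -> exists b, P b /\ forall m, P m -> m <= b.
Proof.
have [k] := ubnP (N - n); elim: k n => // k IHk n ltk Pn PN.
have [[m [Pm ltnm]]|no] := classic (exists m, P m /\ n < m).
  apply: (IHk m) => //; rewrite ltnS in ltk; apply: leq_trans ltk.
  by rewrite ltn_sub2l // (leq_trans ltnm) ?PN.
by exists n; split=> // m Pm; rewrite leqNgt; apply/negP=> ltnm; apply: no; exists m.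
Qed.

Theorem theorem1p3 (d : nat) (hd : 1 <= d) :
  exists b : nat, is_b d b /\
    3 * 2 ^ (d - 1) - 2 <= b <= (d - 1) * 'C(2 * d - 1, d) + 1.
Proof.
pose attained (b : nat) := exists (G : sgraph) (H : {set {set G}}),
  [/\ complete_bipartite G, minimal_edge_cover H, has_degree d H & #|H| = b].
have lower : attained (3 * 2 ^ (d - 1) - 2).
  have [T [I [J [s [t [<- [i0] [j0] [sd td] [st stv]]]]]]] := exact_cross_exists (d - 1).
  by rewrite subn1 prednK // in sd td; apply: exact_cross_realization i0 j0 sd td st stv.
have upper b : attained b -> b <= (d - 1) * 'C(2 * d - 1, d) + 1.
  (* Since d >= 1, 2d - 1 takes the form [d + d.-1] of the earlier bounds. *)
  move=> [G [H [cG mH dH <-]]]; rewrite mul2n -addnn -addnBA // subn1.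
  exact: minimal_edge_cover_card.
have [b [ab bmax]] := bounded_max_exists lower upper.
exists b; split; last by rewrite bmax //= upper.
by split=> // G H cG mH dH; apply: bmax; exists G, H.
Qed.
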